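(* For every integer $n\geq 2$, the group $\mathbb{Z}^n$ has infinite strong cop number, i.e. $\operatorname{sCop}(\mathbb{Z}^n)=\infty$.
   Context: Convention: $\mathbb{N}=\mathbb{Z}_{\geq 1}$. Graphs are connected, undirected, without double edges or loops, with the path metric on vertices. Game. Let $\Gamma$ be a graph. The cops and robbers game on $\Gamma$ has parameters: number of cops $n\in\mathbb{N}$, base point (treasure) $v\in\Gamma$ a vertex, cop speed $\sigma\in\mathbb{N}$, robber speed $\psi\in\mathbb{N}$, cop reach $\rho\in\mathbb{N}$, robber radius $R\in\mathbb{N}$. It is a two-player game with perfect information. First the cop player chooses $n$ vertices as starting positions of the cops, then the robber chooses a vertex as starting position. The players then alternate turns, starting with the cops. In each turn the cop player may move each cop along a path of length at most $\sigma$ to some vertex; then the robber moves along a path of length at most $\psi$ ending in a vertex. One cop move followed by one robber move is a stage. The cop player wins if the robber is captured, i.e. at some time during some stage the robber's position is at distance at most $\rho$ from some cop's position (this includes every vertex traversed by the robber during a move: the robber must traverse the path edge by edge without ever coming within distance $\rho$ of a cop), or if the cops eventually defend $v$, i.e. after some finite initial time the robber never enters the closed ball of radius $R$ around $v$. Otherwise the robber wins. The strong cop number $\operatorname{sCop}(\Gamma)\in\mathbb{N}\cup\{\infty\}$ is the infimum (with $\inf\emptyset=\infty$) of all $n\in\mathbb{N}$ such that $\forall v\in\Gamma,\ \exists\sigma\in\mathbb{N},\ \forall\psi\in\mathbb{N},\ \exists\rho\in\mathbb{N},\ \forall R\in\mathbb{N}$: the cop player has a winning strategy with $n$ cops. This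 number is invariant under quasi-isometry, so for a finitely generated group $G$ one sets $\operatorname{sCop}(G):=\operatorname{sCop}(\operatorname{Cay}(G,S))$ for any finite generating set $S$. *)

(* Defs.v *)
From mathcomp Require Import all_boot all_order all_algebra.
From mathcomp Require Import boolp.

Set Implicit Arguments.
Unset Strict Implicit.
Unset Printing Implicit Defensive.

Import GRing.Theory.

(* The infimum of the empty predicate is [Infty]. *)
Inductive enat : Type := Fin of nat | Infty.

Definition enat_inf (P : nat -> Prop) : enat :=
  if pselect (exists n, `[< P n >]) is left exP then Fin (ex_minn exP)
  else Infty.

Record graph : Type := Graph {
  vertex :> eqType;
  adj : rel vertex;
  adj_sym : symmetric adj;
  adj_irr : irreflexive adj;
  adj_connected : forall x y : vertex,
    exists p : seq vertex, path adj x p /\ last x p = y }.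

Section Game.
Variable Gamma : graph.
Implicit Types (x y v r w : Gamma) (p : seq Gamma).

Lemma dist_ex x y : exists k,
  `[< exists p, [/\ path (@adj Gamma) x p, last x p = y & size p = k] >].
Proof.
have [p [pp lp]] := adj_connected x y.
by exists (size p); apply/asboolP; exists p.
Qed.

Definition dist x y : nat := ex_minn (dist_ex x y).

(* A robber play is his starting vertex [r] and the paths he follows: in
   stage [k] he traverses [m k], listed without its initial vertex. *)
Fixpoint robber_pos r (m : nat -> seq Gamma) (k : nat) : Gamma :=
  if k is k'.+1 then last (robber_pos r m k') (m k') else r.

Definition legal_robber (psi : nat) r (m : nat -> seq Gamma) : Prop :=
  forall k, path (@adj Gamma) (robber_pos r m k) (m k) /\ (size (m k) <= psi)%N.

(* The robber's history (starting vertex and paths followed so far) determines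
   the complete history once the cops' strategy is fixed, so it is the only
   argument of [cop_answer]. *)
Record cop_strategy (n : nat) : Type := CopStrategy {
  cop_start : 'I_n -> Gamma;
  cop_answer : Gamma -> seq (seq Gamma) -> 'I_n -> Gamma }.

(* Positions of the cops after their first [k] moves. *)
Definition cop_pos n (s : cop_strategy n) r (m : nat -> seq Gamma) (k : nat) :
    'I_n -> Gamma :=
  if k is k'.+1 then cop_answer s r (mkseq m k') else cop_start s.

Definition legal_cops n (sigma : nat) (c : nat -> 'I_n -> Gamma) : Prop :=
  forall k i, exists p,
    [/\ path (@adj Gamma) (c k i) p, last (c k i) p = c k.+1 i
      & (size p <= sigma)%N].

(* In stage [k] the cops move to [c k.+1] while the robber stands at
   [robber_pos r m k]; he then traverses [m k]. *)
Definition captured n (rho : nat) (c : nat -> 'I_n -> Gamma) r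
    (m : nat -> seq Gamma) : Prop :=
  (exists i, (dist (c 0 i) r <= rho)%N) \/
  (exists k i w, w \in robber_pos r m k :: m k /\ (dist (c k.+1 i) w <= rho)%N).

Definition defended (v : Gamma) (R : nat) r (m : nat -> seq Gamma) : Prop :=
  exists N, forall k, (N <= k)%N ->
    forall w, w \in robber_pos r m k :: m k -> (R < dist v w)%N.

Definition cops_win (n : nat) v (sigma psi rho R : nat) : Prop :=
  exists s : cop_strategy n,
    forall r (m : nat -> seq Gamma), legal_robber psi r m ->
      legal_cops sigma (cop_pos s r m) /\
      (captured rho (cop_pos s r m) r m \/ defended v R r m).

Definition strong_cop_win (n : nat) : Prop :=
  forall v, exists sigma, (0 < sigma)%N /\
    forall psi, (0 < psi)%N -> exists rho, (0 < rho)%N /\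
      forall R, (0 < R)%N -> cops_win n v sigma psi rho R.

Definition sCop : enat := enat_inf (fun n => (0 < n)%N /\ strong_cop_win n).

End Game.

Section Cayley.
Variables (A : zmodType) (S : seq A).
Local Open Scope ring_scope.

Definition generates : Prop := forall x : A, inIntSpan (in_tuple S) x.

(* The identity may belong to [S]: the first conjunct discards loops. *)
Definition cayley_adj : rel A :=
  fun x y => (x != y) && ((y - x \in S) || (x - y \in S)).

Lemma cayley_adj_sym : symmetric cayley_adj.
Proof. by move=> x y; rewrite /cayley_adj eq_sym orbC. Qed.

Lemma cayley_adj_irr : irreflexive cayley_adj.
Proof. by move=> x; rewrite /cayley_adj eqxx. Qed.

Lemma cayley_connected : generates -> forall x y : A,
  exists p : seq A, path cayley_adj x p /\ last x p = y.
Proof.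
move=> genS.
pose reach z := forall x, exists p, path cayley_adj x p /\ last x p = x + z.
have reach0 : reach 0 by move=> x; exists [::]; rewrite addr0.
have reachD z t : reach z -> reach t -> reach (z + t).
  move=> rz rt x; have [p [pp lp]] := rz x; have [q [pq lq]] := rt (x + z).
  by exists (p ++ q); rewrite cat_path last_cat pp lp lq addrA.
have reach1 z : (z \in S) || (- z \in S) -> reach z.
  move=> Sz x; have [->|z0] := eqVneq z 0; first exact: reach0.
  exists [:: x + z]; split=> //=; rewrite andbT /cayley_adj.
  rewrite [x + z]addrC addrK opprD [- z - x]addrC addrA subrr add0r Sz andbT.
  by apply: contra_neq z0 => e; apply: (addIr x); rewrite add0r -e.
have reachMn z k : reach z -> reach (z *+ k).
  by move=> rz; elim: k => [|k IH]; rewrite ?mulr0n // mulrS; apply: reachD.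
have reachMz z (k : int) : z \in S -> reach (z *~ k).
  move=> Sz; case: k => k; first by apply/reachMn/reach1; rewrite Sz.
  by rewrite NegzE mulrNz -mulNrz; apply/reachMn/reach1; rewrite opprK Sz orbT.
move=> x y; have [a ea] := genS (y - x).
suff /(_ x) [p [pp lp]] : reach (y - x) by exists p; rewrite lp addrC subrK.
rewrite ea; elim/big_ind: _ => // i _.
by apply: reachMz; apply: mem_nth.
Qed.

Definition cayley (genS : generates) : graph :=
  Graph cayley_adj_sym cayley_adj_irr (cayley_connected genS).

End Cayley.

(* Main.v *)
Require Import Defs.
From mathcomp Require Import all_boot all_order all_algebra.
From mathcomp Require Import boolp zify.

(** The robber beats any number N of cops by patrolling a finite grid.

    Take two coordinates of Z^n and, in the plane that they span, N+1 equally
    spaced lines in each of the two directions.  A cop is closer than half the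
    spacing to at most one line of each direction, so by the pigeonhole
    principle some line of each direction is far from all the cops
    ([free_line]).  Time is cut into epochs.  During an epoch the robber
    travels along a line of one direction to its crossing with a line of the
    other direction, chosen among the lines that were far from the cops when the
    epoch began; during the next epoch he travels along that line, and so on.
    A line is thus used until two epochs after it was chosen.  If the robber
    advances by a multiple q of a basis vector in each stage, where q is large
    in terms of N and of the speed of the cops, then during these two epochs the
    cops move by less than half the spacing, so they remain far from the
    robber's line.  They are even beyond their reach when the spacing is large,
    and enlarging the spacing only lengthens the epochs in the same proportion.
    This is consistent with the order of the quantifiers: the robber's speed
    depends only on q, the spacing may depend on the reach of the cops, and the
    radius to be defended is chosen last, so that the grid fits inside the ball.
    The robber returns to a crossing of the grid at the end of each epoch, so
    that the cops never defend the ball.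

    Two ingredients connect this to the game.  A Cayley graph of Z^n is
    compared with the coordinates: distances in the graph bound differences of
    coordinates ([path_spread]), and a fixed set of translations is realised by
    paths of bounded length ([bounded_routes]).  And since cops and robber answer
    each other, the sequence of lines is built by recursion on the epochs
    ([history_choice]). *)

Set Implicit Arguments.
Unset Strict Implicit.
Unset Printing Implicit Defensive.

Import Order.TTheory GRing.Theory Num.Theory.

(** * Plays built from a history *)

(** Course-of-values choice: the robber's decision number [e] has to satisfy a
    condition that the earlier decisions determine, through the answers of the
    cops. *)
Lemma history_choice (A : Type) (a0 : A) (Q : (nat -> A) -> nat -> A -> Prop) :
  (forall f e, exists a, Q f e a) ->
  (forall f g e a, (forall j, (j < e)%N -> f j = g j) -> Q f e a -> Q g e a) ->
  exists f, forall e, Q f e (f e).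
Proof.
move=> Qex Qloc.
have [next nextP] := choice (fun h : seq A => Qex (nth a0 h) (size h)).
pose hist := fix hist e := if e is e'.+1 then rcons (hist e') (next (hist e')) else [::].
pose f e := next (hist e).
have histE e : hist e = mkseq f e by elim: e => //= e IHe; rewrite mkseqS -IHe.
exists f => e; have := nextP (hist e); rewrite -/(f e) histE size_mkseq.
by apply: Qloc => j ltje; rewrite nth_mkseq.
Qed.

Lemma cop_pos_local (Gamma : graph) n (s : cop_strategy Gamma n) r r' m m' k :
  ((0 < k)%N -> r = r') -> (forall j, (j.+1 < k)%N -> m j = m' j) ->
  cop_pos s r m k = cop_pos s r' m' k.
Proof.
case: k => //= k /(_ isT) -> eq_m; congr (cop_answer s r' _).
by apply/eq_in_map => j; rewrite mem_iota => /= ltjk; apply: eq_m.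
Qed.

Lemma dist_path (Gamma : graph) (x y : Gamma) :
  exists p, [/\ path (@adj Gamma) x p, last x p = y & size p = dist x y].
Proof. by rewrite /dist; case: ex_minnP => k /asboolP. Qed.

(** * Walks and lines on a grid *)

(** The median of [a - t], [b] and [a + t]: a walker who goes from [a] towards
    [b] at unit speed and stops there. *)
Definition walk (a b t : nat) : nat := maxn (minn (a + t) b) (a - t).

Lemma walk_step a b t :
  [\/ walk a b t.+1 = walk a b t, walk a b t.+1 = (walk a b t).+1
    | (walk a b t.+1).+1 = walk a b t].
Proof.
case: (ltngtP (walk a b t.+1) (walk a b t)); rewrite /walk;
  [constructor 3 | constructor 2 | constructor 1]; lia.
Qed.

Local Open Scope ring_scope.

(** If each of the [N.+1] lines had a cop closer than half the spacing, two
    lines would share a cop and be closer to each other than the spacing. *)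
Lemma free_line N (x : 'I_N -> int) (w : int) :
  exists2 a : nat, (a <= N)%N & forall i, w <= 2 * `|x i - a%:Z * w|.
Proof.
apply: contrapT => none.
have near (a : 'I_N.+1) : exists i, 2 * `|x i - a%:Z * w| < w.
  apply: contrapT => far; apply: none; exists a; first by rewrite -ltnS.
  by move=> i; rewrite leNgt; apply/negP => lt_w; apply: far; exists i.
have [h hP] := choice near.
suff /leq_card : injective h by rewrite !card_ord ltnn.
move=> a b eq_h; apply/val_inj => /=.
have := hP a; have := hP b; rewrite eq_h; nia.
Qed.

(** * Cayley graphs of Z^n and coordinates *)

Section Cayley.
Variables (n : nat) (S : seq 'rV[int]_n).
Implicit Types (x y z : 'rV[int]_n) (p : seq 'rV[int]_n) (i : 'I_n).

(** A crude bound for the coordinates of all generators, that is a Lipschitz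
    constant of each coordinate for the distance of the Cayley graph. *)
Definition spread : nat := (\sum_(z <- S) \sum_i absz (z 0%R i))%N.

Lemma gen_spread z i : z \in S -> `|z 0 i| <= spread%:Z.
Proof.
move=> Sz; rewrite -abszE lez_nat /spread (big_rem z) //= (bigD1 i) //=.
by rewrite -!addnA leq_addr.
Qed.

Lemma path_spread x p y i : path (cayley_adj S) x p -> y \in x :: p ->
  `|y 0 i - x 0 i| <= (spread * size p)%:Z.
Proof.
elim: p x => [|z p IHp] x /=; first by rewrite inE muln0 => _ /eqP ->; rewrite subrr.
case/andP=> /andP[_ Szx] pz; rewrite inE => /predU1P[->|py].
  by rewrite subrr.
have := IHp _ pz py.
have : `|z 0 i - x 0 i| <= spread%:Z.
  by case/orP: Szx => /(gen_spread i); rewrite !mxE // distrC.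
rewrite mulnS; lia.
Qed.

Lemma dist_spread (genS : generates S) x y i :
  `|y 0 i - x 0 i| <= (spread * dist (x : cayley genS) y)%:Z.
Proof.
have [p [pp <- <-]] := dist_path (x : cayley genS) y.
exact/path_spread/mem_last.
Qed.

Lemma cops_spread (genS : generates S) N sigma
    (c : nat -> 'I_N -> cayley genS) k l j i :
  legal_cops sigma c -> (k <= l)%N ->
  `|(c l j : 'rV_n) 0 i - (c k j : 'rV_n) 0 i| <= (spread * sigma * (l - k))%:Z.
Proof.
move=> legal_c; elim: l => [|l IHl]; first by case: k => // _; rewrite subrr.
rewrite leq_eqVlt => /predU1P[->|]; first by rewrite subrr.
rewrite ltnS => lekl; rewrite subSn // mulnS PoszD -(subrKA ((c l j : 'rV_n) 0 i)).
apply: le_trans (ler_normD _ _) (lerD _ (IHl lekl)).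
have [p [pp <- le_p]] := legal_c l j.
apply: le_trans (path_spread i pp (mem_last _ _)) _.
by rewrite lez_nat leq_mul2l le_p orbT.
Qed.

Lemma translate_path x z p :
  path (cayley_adj S) (x + z) (map (+%R x) p) = path (cayley_adj S) z p.
Proof.
elim: p z => //= y p IHp z; rewrite IHp /cayley_adj.
by rewrite (inj_eq (addrI x)) !opprD !addrA [x + y - x]addrAC [x + z - x]addrAC subrr !add0r.
Qed.

(** Translations are automorphisms of a Cayley graph, so a path from 0 to [z]
    yields paths of the same length between any two points that differ by [z].
    For the steps of the robber, this length is the speed that he needs. *)
Lemma bounded_routes (genS : generates S) (zs : seq 'rV[int]_n) :
  exists2 psi, (0 < psi)%N & forall x y, y - x \in zs ->
    exists p, [/\ path (cayley_adj S) x p, last x p = y & (size p <= psi)%N].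
Proof.
elim: zs => [|z zs [psi psi_gt0 IHzs]]; first by exists 1%N.
have [q [pq lq]] := cayley_connected genS 0 z.
exists (psi + size q)%N => [|x y]; first by rewrite ltn_addr.
rewrite inE => /predU1P[eq_z|/IHzs[p [pp lp le_p]]]; last first.
  by exists p; split=> //; rewrite (leq_trans le_p) ?leq_addr.
exists (map (+%R x) q); rewrite size_map leq_addl; split=> //.
  by have := translate_path x 0 q; rewrite addr0 pq.
by rewrite -[X in last X]addr0 last_map lq -eq_z addrC subrK.
Qed.

End Cayley.

(** * The robber's itinerary *)

Section Grid.
Variables (n : nat) (i0 i1 : 'I_n) (q ell N : nat).
Hypothesis i01 : i0 != i1.

Definition axis (b : bool) : 'I_n := if b then i1 else i0.

(** The boolean says which of the two axes carries the first argument, so that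
    a crossing can be read along either of its two lines. *)
Definition grid_pt (b : bool) (x y : nat) : 'rV[int]_n :=
  (q * x)%:Z *: delta_mx 0 (axis b) + (q * y)%:Z *: delta_mx 0 (axis (~~ b)).

Lemma grid_ptC b x y : grid_pt b x y = grid_pt (~~ b) y x.
Proof. by rewrite /grid_pt negbK addrC. Qed.

Lemma grid_pt_coord b x y : grid_pt b x y 0 (axis b) = (q * x)%:Z.
Proof.
rewrite !mxE !eqxx; have -> : axis b == axis (~~ b) = false.
  by case: b; rewrite /axis //= ?[i1 == _]eq_sym (negPf i01).
by rewrite mulr1 mulr0 addr0.
Qed.

Definition steps : seq 'rV[int]_n :=
  [seq c *: delta_mx 0 (axis b) | c <- [:: 0; q%:Z; - q%:Z], b <- [:: false; true]].

Lemma grid_pt_step b x x' y : [\/ x' = x, x' = x.+1 | x'.+1 = x] ->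
  grid_pt b x' y - grid_pt b x y \in steps.
Proof.
move=> near; rewrite /grid_pt opprD addrACA subrr addr0 -scalerBl.
apply: (allpairs_f (fun c b => c *: delta_mx 0 (axis b))); last by case: b.
by rewrite !inE; case: near => [->|->|<-]; apply/or3P;
  [constructor 1|constructor 2|constructor 3]; apply/eqP; lia.
Qed.

(** In epoch [e] the robber walks in the direction [axis (odd e)], from the line
    [f e] to the line [f e.+2], on the line [f e.+1] of the other direction. *)
Definition leg (f : nat -> nat) (e t : nat) : 'rV[int]_n :=
  grid_pt (odd e) (walk (ell * f e) (ell * f e.+2) t) (ell * f e.+1).

(** Two lines of the same direction are at most [N * ell] steps apart, so this
    many stages suffice for each epoch. *)
Definition itinerary (f : nat -> nat) (k : nat) : 'rV[int]_n :=
  leg f (k %/ (N * ell)) (k %% (N * ell)).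

(** The case [t = N * ell] is the reason for this lemma: the end of a leg is the
    beginning of the next one, with the two axes exchanged. *)
Lemma itineraryE f e t : (forall e, f e <= N)%N -> (0 < N * ell)%N ->
  (t <= N * ell)%N -> itinerary f (e * (N * ell) + t) = leg f e t.
Proof.
move=> f_le T_gt0; rewrite leq_eqVlt => /predU1P[->|ltT]; last first.
  by rewrite /itinerary divnMDl // modnMDl divn_small // modn_small // addn0.
rewrite addnC -mulSn -[(_ * _)%N]addn0 /itinerary divnMDl // modnMDl.
rewrite divn_small // mod0n addn0 /leg [RHS]grid_ptC.
congr (grid_pt _ _ _); rewrite /walk; first by lia.
have := leq_mul (leqnn ell) (f_le e); have := leq_mul (leqnn ell) (f_le e.+2); lia.
Qed.

Lemma itinerary_step f k : (forall e, f e <= N)%N -> (0 < N * ell)%N ->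
  itinerary f k.+1 - itinerary f k \in steps.
Proof.
move=> f_le T_gt0; have ltT := ltn_pmod k T_gt0.
rewrite [X in itinerary f X.+1](divn_eq k (N * ell)) -addnS itineraryE //.
exact/grid_pt_step/walk_step.
Qed.

End Grid.

(** * Evading the cops *)

Section Evasion.
Variables (n : nat) (S : seq 'rV[int]_n) (genS : generates S) (i0 i1 : 'I_n).
Hypothesis i01 : i0 != i1.

(** The constants are such that [2 * T] stages of the cops, [T = N * ell] being
    the length of an epoch, cost them less than half of the spacing [ell * q] in each
    coordinate: this is the role of [q].  The remaining margin grows with
    [ell], and covers both the reach of the cops and the excursions of the robber
    within a single stage (see [room]). *)
Lemma robber_evades N sigma : (0 < N)%N ->
  exists2 psi, (0 < psi)%N & forall rho, exists2 R, (0 < R)%N &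
    ~ cops_win N ((0 : 'rV[int]_n) : cayley genS) sigma psi rho R.
Proof.
move=> N_gt0; pose q := (4 * N * spread S * sigma + 1)%N.
have [psi psi_gt0 routes] := bounded_routes genS (steps i0 i1 q).
exists psi => // rho; pose ell := (2 * spread S * (psi + rho) + 1)%N.
pose T := (N * ell)%N.
have T_gt0 : (0 < T)%N by rewrite /T muln_gt0 N_gt0 /ell addn1.
pose origin : cayley genS := (0 : 'rV[int]_n).
pose junction (u : bool * 'I_N.+1 * 'I_N.+1) : cayley genS :=
  grid_pt i0 i1 q u.1.1 (ell * u.1.2) (ell * u.2).
exists (\max_u dist origin (junction u)).+1 => // -[s s_wins].
have routes_total (xy : 'rV[int]_n * 'rV[int]_n) :
    exists p, xy.2 - xy.1 \in steps i0 i1 q ->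
    [/\ path (cayley_adj S) xy.1 p, last xy.1 p = xy.2 & (size p <= psi)%N].
  case: xy => x y /=; have [/routes[p pP]|_] := boolP (y - x \in _); first by exists p.
  by exists [::].
have [route routeP] := choice routes_total.
pose pos f := itinerary i0 i1 q ell N f : nat -> cayley genS.
pose moves f k : seq (cayley genS) := route (pos f k, pos f k.+1).
pose cops f := cop_pos s (pos f 0%N) (moves f).
(* The line [f e] is used during epoch [e - 1], but is already the destination
   of epoch [e - 2], at whose start it is chosen.  For [e < 2] the truncated
   subtraction gives time 0, when only the initial positions of the cops matter. *)
pose free f e a := (a <= N)%N /\
  forall j, (ell * q)%:Z <=
    2 * `|(cops f ((e - 2) * T)%N j : 'rV_n) 0 (axis i0 i1 (odd e))
          - a%:Z * (ell * q)%:Z|.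
have [f fP] : exists f, forall e, free f e (f e).
  apply: (history_choice 0%N) => [f e|f g e a eq_fg].
    by have [a a_le aP] := free_line
      (fun j => (cops f ((e - 2) * T)%N j : 'rV_n) 0 (axis i0 i1 (odd e)))
      (ell * q)%:Z; exists a.
  (* The cops' positions at the start of epoch [e - 2] answer the robber's moves
     before that time, which depend only on his lines up to [f (e - 1)]. *)
  have eq_pos k : (k < (e - 2) * T)%N -> pos f k = pos g k.
    rewrite -ltn_divLR // => lt_k.
    rewrite /pos /itinerary -/T /leg; move: (k %/ T)%N lt_k => u lt_u.
    by rewrite !eq_fg //; lia.
  rewrite /free /cops; suff -> : cop_pos s (pos f 0%N) (moves f) ((e - 2) * T)
    = cop_pos s (pos g 0%N) (moves g) ((e - 2) * T) by [].
  apply: cop_pos_local => [/eq_pos //|k lt_k].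
  by rewrite /moves !eq_pos // ltnW.
have f_le e : (f e <= N)%N by case: (fP e).
have posE k : robber_pos (pos f 0%N) (moves f) k = pos f k.
  elim: k => //= k ->.
  by case: (routeP (pos f k, pos f k.+1)); rewrite ?itinerary_step.
have legal_moves : legal_robber psi (pos f 0%N) (moves f).
  move=> k; rewrite posE.
  by case: (routeP (pos f k, pos f k.+1)); rewrite ?itinerary_step.
have [legal_c outcome] := s_wins _ _ legal_moves.
have posT e t : (t <= T)%N -> pos f (e * T + t)%N = leg i0 i1 q ell f e t.
  exact: itineraryE.
have line e t : (t <= T)%N ->
    (pos f (e * T + t)%N : 'rV_n) 0 (axis i0 i1 (odd e.+1))
      = (f e.+1)%:Z * (ell * q)%:Z.
  move=> le_t; rewrite posT // /leg grid_ptC grid_pt_coord //; lia.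
have room : (2 * spread S * (psi + rho) + 4 * spread S * sigma * T < ell * q)%N.
  rewrite /T /q; set D := spread S; move: (leqnn ell); rewrite {2}/ell -/D.
  by nia.
(* The line [f e.+1] that carries the robber in epoch [e] was free at time
   [(e - 1) * T], and at most [2 * T] stages have passed since then. *)
have safe e t l j (w : cayley genS) : (t <= T)%N ->
    ((e - 1) * T <= l)%N -> (l <= e.+1 * T)%N ->
    w \in pos f (e * T + t)%N :: moves f (e * T + t)%N ->
    (rho < dist (cops f l j) w)%N.
  move=> le_t ge_l le_l w_in; rewrite ltnNge; apply/negP => caught.
  pose c := axis i0 i1 (odd e.+1).
  have w_near : `|(w : 'rV_n) 0 c - (f e.+1)%:Z * (ell * q)%:Z|
      <= (spread S * psi)%:Z.
    have [|path_m _ le_m] := routeP (pos f (e * T + t)%N, pos f (e * T + t).+1).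
      exact: itinerary_step.
    rewrite -(line _ _ le_t); apply: le_trans (path_spread c path_m w_in) _.
    by rewrite lez_nat leq_mul2l le_m orbT.
  have w_cop : `|(w : 'rV_n) 0 c - (cops f l j : 'rV_n) 0 c| <= (spread S * rho)%:Z.
    apply: le_trans (dist_spread genS _ _ c) _.
    by rewrite lez_nat leq_mul2l caught orbT.
  have drift : `|(cops f l j : 'rV_n) 0 c - (cops f ((e - 1) * T)%N j : 'rV_n) 0 c|
      <= (spread S * sigma * (2 * T))%:Z.
    apply: le_trans (cops_spread j c legal_c ge_l) _.
    rewrite lez_nat leq_mul2l; apply/orP; right.
    by move: ge_l le_l; case: (e) => [|u]; rewrite ?subn1 ?mulSn /=; lia.
  have [_ /(_ j)] := fP e.+1; rewrite -/c [(e.+1 - 2)%N](_ : _ = e - 1)%N; last by lia.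
  move: ((w : 'rV_n) 0 c) ((cops f l j : 'rV_n) 0 c) ((cops f ((e - 1) * T)%N j : 'rV_n) 0 c)
    ((f e.+1)%:Z * (ell * q)%:Z) w_near w_cop drift room; clear; lia.
case: outcome => [[[j]|[k [j [w []]]]]|[M escaped]].
- have := safe 0%N 0%N 0%N j (pos f 0%N) (leq0n _) isT (leq0n _) (mem_head _ _).
  by rewrite ltnNge => /negP.
- have lt_t := ltn_pmod k T_gt0; have def_k := divn_eq k T.
  rewrite posE {1 2}def_k => w_in.
  have [ge_l le_l] : ((k %/ T - 1) * T <= k.+1)%N /\ (k.+1 <= (k %/ T).+1 * T)%N.
    move: lt_t def_k; clear; case: (k %/ T)%N => [|u]; rewrite ?subn1 ?mulSn /=; lia.
  by have := safe _ _ k.+1 j w (ltnW lt_t) ge_l le_l w_in; rewrite ltnNge => /negP.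
have le_M_MT : (M <= M * T)%N by rewrite leq_pmulr.
have := escaped _ le_M_MT (pos f (M * T)%N).
rewrite posE mem_head => /(_ isT); apply/negP; rewrite -leqNgt leqW //.
have -> : pos f (M * T)%N = junction (odd M, inord (f M), inord (f M.+1)).
  rewrite -[(M * T)%N]addn0 posT // /junction /leg !inordK ?ltnS //=.
  by congr (grid_pt _ _ _ _ _ _); rewrite /walk; lia.
exact: (leq_bigmax (F := fun u => dist origin (junction u))).
Qed.

End Evasion.

Theorem theorem1p3 (n : nat) (hn : (2 <= n)%N)
    (S : seq 'rV[int]_n) (genS : generates S) :
  sCop (cayley genS) = Infty.
Proof.
rewrite /sCop /enat_inf; case: pselect => // exN; have [N /asboolP[N_gt0 win]] := exN; exfalso.
have [sigma [_ win_sigma]] := win (0 : 'rV[int]_n).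
have i01 : Ordinal (ltnW hn) != Ordinal hn by [].
have [psi psi_gt0 evade] := robber_evades genS i01 sigma N_gt0.
have [rho [_ win_rho]] := win_sigma psi psi_gt0.
have [R R_gt0 []] := evade rho.
exact: win_rho.
Qed.
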